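(* Let $n\ge 2$ and suppose the players' values satisfy $v_1 > v = v_2 = v_3 = \cdots = v_n > 0$. Then, among all formats for $n$ players, the unique format that minimizes $P_1$ is the one that has exactly one match in each round.
   Context: Random knockout tournament: there are $n\ge 2$ players $1,\dots,n$ with positive values $v_1,\dots,v_n$. A format is a tuple $(r,m_1,\dots,m_r)$ of positive integers with $\sum_{s=1}^r m_s = n-1$ and $2m_s \le r_s$ for each $s$, where $r_s = n-\sum_{j=1}^{s-1} m_j$ is the number of players still alive (not eliminated) at the start of round $s$. In round $s$, independently of the past given the set of alive players, $2m_s$ of the $r_s$ alive players are chosen uniformly at random and are uniformly randomly arranged into $m_s$ match pairs. A match between $i$ and $j$ is won by $i$ with probability $v_i/(v_i+v_j)$, independently of everything else. Losers are eliminated; the winners and the alive players not chosen to play advance to the next round. After round $r$ exactly one player remains, the winner of the tournament. $P_i$ denotes the probability that player $i$ wins the tournament (it depends on the format). The format with exactly one match in each round is $r=n-1$, $m_1=\cdots=m_{n-1}=1$. *)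

(* Defs.v *)
From HB Require Import structures.
From mathcomp Require Import all_boot all_order all_algebra.
Set Implicit Arguments.
Unset Strict Implicit.
Unset Printing Implicit Defensive.
Import Order.TTheory GRing.Theory Num.Theory.
Local Open Scope ring_scope.

(* A format (r, m_1, ..., m_r) is encoded as the sequence [:: m_1; ...; m_r],
   so r is its size and m_(s+1) is its s-th entry counted from 0; accordingly
   alive_before n m s is the number of players alive before round s+1. The
   truncated subtraction is harmless since the m_j sum to n - 1. *)
Definition alive_before (n : nat) (m : seq nat) (s : nat) : nat :=
  (n - \sum_(0 <= j < s) nth 0 m j)%N.

Definition is_format (n : nat) (m : seq nat) : Prop :=
  [/\ forall s, (s < size m)%N -> (0 < nth 0 m s)%N,
      (\sum_(0 <= s < size m) nth 0 m s = n - 1)%N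
    & forall s, (s < size m)%N -> (2 * nth 0 m s <= alive_before n m s)%N].

Definition one_match_per_round (n : nat) : seq nat := nseq (n - 1) 1%N.

Section Tournament.
Variables (R : realFieldType) (n : nat) (v : 'I_n -> R).
Implicit Types (A B S W : {set 'I_n}) (M : {set {set 'I_n}}).

Definition draws (k : nat) A : {set {set 'I_n}} :=
  [set S : {set 'I_n} | (S \subset A) && (#|S| == 2 * k)%N].

Definition pairings S : {set {set {set 'I_n}}} :=
  [set M : {set {set 'I_n}} | partition M S && [forall B in M, #|B| == 2%N]].

(* W is the set of winners: it contains exactly one player of each pair B of M,
   so the two inner products range over the winner i and the loser j of B. *)
Definition outcome_prob M W : R :=
  \prod_(B in M) \prod_(i in B :&: W) \prod_(j in B :\: W) (v i / (v i + v j)).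

(* Probability that a round of k matches turns the set A of alive players
   into A': the set S of players of the round is uniform among the 2k-subsets
   of A, and given S the pairing M is uniform among the pairings of S. *)
Definition round_law (k : nat) A A' : R :=
  \sum_(S in draws k A) #|draws k A|%:R^-1 *
    \sum_(M in pairings S) #|pairings S|%:R^-1 *
      \sum_(W : {set 'I_n} | is_transversal W M S && (A :\: (S :\: W) == A'))
        outcome_prob M W.

(* Law of the final set of alive players when the rounds m are played
   starting from A: the sets of alive players form a Markov chain. *)
Fixpoint alive_law (m : seq nat) A A' : R :=
  if m is k :: m' then
    \sum_(C : {set 'I_n}) round_law k A C * alive_law m' C A'
  else (A == A')%:R.

Definition win_prob (m : seq nat) (i : 'I_n) : R :=
  alive_law m [set: 'I_n] [set i].

Definition minimizes_win_prob (i : 'I_n) (m : seq nat) : Prop :=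
  is_format n m /\
  forall m', is_format n m' -> win_prob m i <= win_prob m' i.

End Tournament.

Definition player1 (n : nat) (hn : (2 <= n)%N) : 'I_n := Ordinal (ltnW hn).

(* Main.v *)
Require Import Defs.
From mathcomp Require Import all_boot all_order all_algebra.
From mathcomp Require Import ring lra zify.
Import Order.TTheory GRing.Theory Num.Theory.
Local Open Scope ring_scope.

Set Implicit Arguments.
Unset Strict Implicit.

(** Write i for the strong player and x = 2 w / (v i + w) for twice the
    probability that i loses a match; since w < v i, 0 < x < 1. Because all
    opponents of i have the same value, a round of k matches among r players
    eliminates i with probability (2 k / r) (x / 2) = k x / r, whoever else is
    alive. As each round of k matches removes exactly k players, the winning
    probability of i is the product over the rounds of 1 - k x / r
    ([alive_law_survival]), a function of the numbers alone.

    It remains to minimize that product. One match followed by k matches is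
    worse for i than k + 1 simultaneous matches:
      1 - (k+1) x / (n+1) - (1 - x / (n+1)) (1 - k x / n)
        = k x (1 - x) / (n (n+1)) > 0,
    where the sign is that of 1 - x, so this is where i being the stronger
    player counts. Peeling off matches one at a time, a round of k >= 2 matches
    is strictly beaten by k rounds of one match ([split_round]); doing so in
    every round gives the inequality together with its equality case
    ([survival_min]).

    The link with the tournament is a computation of an expectation. Given the
    pairing, the set of winners is a transversal of it and its probability is a
    product over the pairs, so that sums over transversals factor over the
    pairs ([sum_transversal_prod]): every pair without i contributes 1 and a
    pair with i contributes v i / (v i + w) ([sum_outcome_prob_survival]).
    Counting the draws that avoid i then gives [round_survival]. *)

(** * Sums over transversals and pairings *)

(** A transversal is a choice of one element in each block, so this is the
    distributivity of products over sums, read through the bijection between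
    choice functions f and their images f @: M. The element x0 is the value of
    choice functions outside M. *)
Lemma sum_transversal_prod (R : comPzSemiRingType) (T : finType) (x0 : T)
    (M : {set {set T}}) (S : {set T}) (F : {set T} -> {set T} -> R) :
  partition M S ->
  \sum_(W : {set T} | is_transversal W M S) \prod_(B in M) F B (B :&: W)
    = \prod_(B in M) \sum_(i in B) F B [set i].
Proof.
move=> parM; have [/eqP covM triM _] := and3P parM.
(* The finite functions in pfamily x0 M select an element of each block of M
   and are x0 elsewhere, which makes them determined by their image. *)
pose choices := pfamily x0 (mem M) (fun B : {set T} => mem B).
have choiceI (f : {ffun {set T} -> T}) (B : {set T}) : f \in choices ->
    B \in M -> B :&: f @: M = [set f B].
  case/pfamilyP=> _ fin BM; apply/setP=> y; rewrite !inE.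
  apply/andP/eqP=> [[yB /imsetP [C CM yC]]|->]; last first.
    by split; [exact: fin | apply: imset_f].
  have yinC : y \in C by rewrite yC; apply: fin.
  by rewrite yC -(def_pblock triM BM yB) (def_pblock triM CM yinC).
rewrite (big_distr_big_dep x0) /=.
pose choice (W : {set T}) : {ffun {set T} -> T} :=
  [ffun B => if B \in M then transversal_repr x0 W B else x0].
rewrite (reindex_onto (fun f : {ffun {set T} -> T} => f @: M) choice) /=;
    last first.
  move=> W trW; rewrite -[RHS](im_transversal_repr trW x0).
  by apply: eq_in_imset => B BM; rewrite ffunE BM.
apply: eq_big => [f|f /andP [trW /eqP ef]]; last first.
  apply: eq_bigr => B BM.
  by rewrite setIC (setI_transversal_pblock trW x0 BM) -{2}ef ffunE BM.
apply/andP/idP => [[trW /eqP <-]|fF].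
  apply/pfamilyP; split=> [|B BM]; last first.
    by rewrite ffunE BM; apply: (repr_mem_pblock trW).
  by apply/supportP=> B nBM; rewrite ffunE (negPf nBM).
have [/supportP supf fin] := pfamilyP fF.
have trW : is_transversal (f @: M) M S.
  apply/and3P; split=> //.
    apply/subsetP=> _ /imsetP [B BM ->]; rewrite -covM.
    by apply/bigcupP; exists B => //; apply: fin.
  by apply/forall_inP=> B BM; rewrite setIC choiceI // cards1.
split=> //; apply/eqP/ffunP=> B; rewrite ffunE; case: ifP => BM; last first.
  by rewrite supf //= BM.
apply/set1P; rewrite -choiceI // setIC.
by rewrite (setI_transversal_pblock trW x0 BM) set11.
Qed.

(** The uniform law on the pairings of S divides by their number; this is what
    makes its weights sum to 1. *)
Lemma pairings_nonempty (n k : nat) (S : {set 'I_n}) :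
  #|S| = (2 * k)%N -> (0 < #|pairings S|)%N.
Proof.
elim: k S => [|k IHk] S cS.
  have -> : S = set0 by apply/eqP; rewrite -cards_eq0 cS.
  apply/card_gt0P; exists set0; rewrite inE partition_set0 eqxx.
  by apply/forall_inP=> B; rewrite inE.
have /card_gt0P [a aS] : (0 < #|S|)%N by rewrite cS mulnS.
have /card_gt0P [b bS] : (0 < #|S :\ a|)%N.
  by move: (cardsD1 a S); rewrite aS cS; lia.
pose P := [set a; b].
have cP : #|P| = 2 by move: bS; rewrite cards2 !inE eq_sym => /andP [->].
have sPS : P \subset S.
  by apply/subsetP=> y; move: bS; rewrite !inE => /andP [_ bS] /orP [] /eqP ->.
have /IHk/card_gt0P [M] : #|S :\: P| = (2 * k)%N.
  by rewrite cardsD (setIidPr sPS) cP cS; lia.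
rewrite inE => /andP [parM /forall_inP cM].
apply/card_gt0P; exists (P |: M); rewrite inE; apply/andP; split.
  have -> : S = P :|: (S :\: P) by rewrite -{1}(setIidPr sPS) setID.
  apply: partitionU1 => //.
    by rewrite -card_gt0 cP.
  by rewrite -setI_eq0 setIDA setD_eq0 subsetIl.
by apply/forall_inP=> B; rewrite !inE => /orP [/eqP ->|/cM //]; rewrite cP.
Qed.

(** * One round of the tournament *)

(** Half of the players of the round are losers, so the number of alive players
    after a round is deterministic. *)
Lemma card_survivors (n k : nat) (A S W : {set 'I_n}) (M : {set {set 'I_n}}) :
  S \in draws k A -> M \in pairings S -> is_transversal W M S ->
  #|A :\: (S :\: W)| = (#|A| - k)%N.
Proof.
rewrite !inE => /andP [SA /eqP cS] /andP [parM /forall_inP cM] trW.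
have WS := transversal_sub trW.
have cW : #|S| = (#|W| * 2)%N.
  rewrite (card_transversal trW); apply: card_uniform_partition parM => B BM.
  exact/eqP/cM.
rewrite cardsD (setIidPr (subset_trans (subsetDl _ _) SA)).
by rewrite cardsD (setIidPr WS); congr (_ - _)%N; lia.
Qed.

(** A player of A is left out of the draw with probability 1 - 2 k / #|A|. *)
Lemma card_draws_without (n k : nat) (i : 'I_n) (A : {set 'I_n}) : i \in A ->
  (#|A| * #|[set S in draws k A | i \notin S]|
     = (#|A| - 2 * k) * #|draws k A|)%N.
Proof.
move=> iA.
have -> : [set S in draws k A | i \notin S] = draws k (A :\ i).
  by apply/setP=> S; rewrite !inE subsetD1 andbAC.
rewrite /draws !cards_draws -mul_bin_down; congr (_ * 'C(_, _))%N.
by rewrite (cardsD1 i A) iA.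
Qed.

(** The expectation of h over the next set of alive players, computed by
    averaging over the draw, the pairing and the results in turn. *)
Lemma sum_round_law (R : realFieldType) (n : nat) (v : 'I_n -> R) (k : nat)
    (A : {set 'I_n}) (h : {set 'I_n} -> R) :
  \sum_(C : {set 'I_n}) round_law v k A C * h C
    = \sum_(S in draws k A) #|draws k A|%:R^-1 *
        \sum_(M in pairings S) #|pairings S|%:R^-1 *
          \sum_(W : {set 'I_n} | is_transversal W M S)
            outcome_prob v M W * h (A :\: (S :\: W)).
Proof.
under eq_bigr => C _ do rewrite /round_law mulr_suml.
rewrite exchange_big /=; apply: eq_bigr => S _.
under eq_bigr => C _ do rewrite -mulrA mulr_suml.
rewrite -mulr_sumr exchange_big /=; congr (_ * _); apply: eq_bigr => M _.
under eq_bigr => C _ do rewrite -mulrA mulr_suml big_mkcondr /=.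
rewrite -mulr_sumr exchange_big /=; congr (_ * _); apply: eq_bigr => W _.
rewrite (bigD1 (A :\: (S :\: W))) //= eqxx big1 ?addr0 // => C nC.
by rewrite eq_sym (negPf nC).
Qed.

Section Survival.
Variables (R : realFieldType) (n : nat) (v : 'I_n -> R) (i : 'I_n) (w : R).
Hypotheses (v_gt0 : forall j, 0 < v j) (v_eq : forall j, j != i -> v j = w).
Hypothesis w_gt0 : 0 < w.

(** Surviving the round means not losing in any pair, so the indicator of
    survival is itself a product over the pairs and the sum factors. The factor
    of a pair {a, b} is the total probability 1 of its two results, unless i is
    one of the two, in which case only the victory of i counts. *)
Lemma sum_outcome_prob_survival (M : {set {set 'I_n}}) (S : {set 'I_n}) :
  M \in pairings S ->
  \sum_(W : {set 'I_n} | is_transversal W M S)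
      outcome_prob v M W * (i \notin S :\: W)%:R
    = if i \in S then v i / (v i + w) else 1.
Proof.
rewrite inE => /andP [parM /forall_inP cM].
have [/eqP covM triM _] := and3P parM.
(* X stands for the singleton of the winner of B. *)
pose F (B X : {set 'I_n}) : R :=
  (\prod_(a in X) \prod_(b in B :\: X) (v a / (v a + v b)))
    * (i \notin B :\: X)%:R.
have eI (B W : {set 'I_n}) : B :\: (B :&: W) = B :\: W.
  by rewrite setDIr setDv set0U.
transitivity (\sum_(W : {set 'I_n} | is_transversal W M S)
                \prod_(B in M) F B (B :&: W)).
  apply: eq_bigr => W _; rewrite /F big_split /=; congr (_ * _).
    by apply: eq_bigr => B _; rewrite eI.
  rewrite -natr_prod; congr (_%:R); rewrite -covM.
  case: (boolP (i \in _)) => /= iW.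
    move: iW; rewrite inE => /andP [niW /bigcupP [B BM iB]].
    by rewrite (bigD1 B) //= eI inE niW iB mul0n.
  rewrite big1 // => B BM; rewrite eI; case: (boolP (i \in _)) => //= iBW.
  case/negP: iW; move: iBW; rewrite !inE => /andP [-> iB].
  by apply/bigcupP; exists B.
rewrite (sum_transversal_prod i F parM).
have blockE B : B \in M ->
    \sum_(j in B) F B [set j] = if i \in B then v i / (v i + w) else 1.
  move=> BM; have /cards2P [a [b [ab ->]]] : #|B| == 2 := cM B BM.
  have Fa (x y : 'I_n) : x != y ->
      F [set x; y] [set x] = v x / (v x + v y) * (i != y)%:R.
    move=> xy; rewrite /F big_set1.
    have -> : [set x; y] :\: [set x] = [set y].
      apply/setP=> z; rewrite !inE.
      by case: (eqVneq z x) => [->|//] /=; rewrite (negPf xy).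
    by rewrite big_set1 inE.
  rewrite big_setU1 ?inE //= big_set1 Fa // setUC (Fa b a) 1?[b == a]eq_sym //.
  have D (x y : 'I_n) : v x + v y != 0 by rewrite gt_eqF // addr_gt0.
  case: (eqVneq i b) ab => [<- ai|_ ab].
    by rewrite orbT [i == a]eq_sym ai mulr0 add0r mulr1 (v_eq ai).
  case: (eqVneq i a) ab => [<- ib|_ _] /=.
    by rewrite mulr1 mulr0 addr0 (v_eq (j := b)) // eq_sym.
  by rewrite !mulr1 [v b + _]addrC -mulrDl divff.
rewrite (eq_bigr _ blockE); case: ifPn => iS.
  have iM : pblock M i \in M by rewrite pblock_mem // covM.
  rewrite (bigD1 _ iM) /= mem_pblock covM iS big1 ?mulr1 // => B /andP [BM nB].
  by case: ifP => // iB; rewrite (def_pblock triM BM iB) eqxx in nB.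
rewrite big1 // => B BM; case: ifP => // iB.
by case/negP: iS; rewrite -covM; apply/bigcupP; exists B.
Qed.

(** With p = v i / (v i + w), the player i survives with probability p if drawn
    and 1 otherwise, hence with probability 1 - (2 k / #|A|) (1 - p), where
    2 (1 - p) = 2 w / (v i + w). *)
Lemma round_survival (k : nat) (A : {set 'I_n}) :
  (0 < #|A|)%N -> (2 * k <= #|A|)%N ->
  \sum_(C : {set 'I_n}) round_law v k A C * (i \in C)%:R
    = (i \in A)%:R * (1 - k%:R * (2 * w / (v i + w)) / #|A|%:R).
Proof.
move=> A_gt0 le2kA; rewrite sum_round_law.
case: (boolP (i \in A)) => iA; last first.
  rewrite mul0r big1 // => S _; rewrite big1 ?mulr0 // => M _.
  rewrite big1 ?mulr0 // => W _.
  by rewrite inE (negPf iA) andbF mulr0.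
have pairE (S : {set 'I_n}) : S \in draws k A ->
    \sum_(M in pairings S) #|pairings S|%:R^-1 *
      (\sum_(W : {set 'I_n} | is_transversal W M S)
         outcome_prob v M W * (i \in A :\: (S :\: W))%:R)
    = if i \in S then v i / (v i + w) else 1.
  rewrite inE => /andP [_ /eqP cS].
  have P_gt0 := pairings_nonempty cS.
  transitivity (\sum_(M in pairings S) #|pairings S|%:R^-1 *
                  (if i \in S then v i / (v i + w) else 1)).
    apply: eq_bigr => M MS; congr (_ * _).
    rewrite -(sum_outcome_prob_survival MS); apply: eq_bigr => W _.
    by rewrite inE iA andbT.
  rewrite -mulr_suml sumr_const -[_^-1 *+ _]mulr_natr mulVf ?mul1r //.
  by rewrite pnatr_eq0 -lt0n.
have D_gt0 : (0 < #|draws k A|)%N by rewrite cards_draws bin_gt0.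
have d0E : (#|A| * #|[set S in draws k A | i \notin S]|
    = (#|A| - 2 * k) * #|draws k A|)%N := card_draws_without k iA.
pose p := v i / (v i + w).
transitivity (#|draws k A|%:R^-1 *
    \sum_(S in draws k A) (p + (1 - p) * (i \notin S)%:R)).
  rewrite mulr_sumr; apply: eq_bigr => S SA; rewrite (pairE S SA).
  by rewrite -/p; case: (i \in S) => /=; ring.
rewrite big_split /= sumr_const -mulr_sumr -natr_sum.
have -> : (\sum_(S in draws k A) (i \notin S)
    = #|[set S in draws k A | i \notin S]|)%N.
  rewrite -sum1dep_card [RHS]big_mkcondr.
  by apply: eq_bigr => S _; case: (i \in S).
move/(congr1 (fun c => c%:R : R)): d0E; rewrite !natrM natrB // natrM.
set d0 := #|[set _ in _ | _]|; rewrite -[p *+ _]mulr_natr => d0E.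
have D0 : (#|draws k A|%:R : R) != 0 by rewrite pnatr_eq0 -lt0n.
have A0 : (#|A|%:R : R) != 0 by rewrite pnatr_eq0 -lt0n.
have vw0 : v i + w != 0 by rewrite gt_eqF // addr_gt0.
have -> : (d0%:R : R) = (#|A|%:R - 2 * k%:R) * #|draws k A|%:R / #|A|%:R.
  by rewrite -d0E mulrAC divff // mul1r.
by rewrite /p; field; rewrite D0 A0 vw0.
Qed.
End Survival.

(** * Formats *)

Lemma is_format_cons (n k : nat) (m : seq nat) :
  is_format n (k :: m) -> [/\ (0 < k)%N, (2 * k <= n)%N & is_format (n - k) m].
Proof.
case=> pos; rewrite /= big_nat_recl //= => tot half.
split; first exact: (pos 0).
  by move: (half 0 isT); rewrite /alive_before big_geq // subn0.
split=> [s sm||s sm]; first exact: (pos s.+1).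
  lia.
move: (half s.+1 sm); rewrite /alive_before big_nat_recl //=.
by rewrite subnDA.
Qed.

Lemma is_format_one_match (n : nat) : is_format n (one_match_per_round n).
Proof.
have nth_one s : (s < n - 1)%N -> nth 0%N (one_match_per_round n) s = 1%N.
  by move=> sn; rewrite nth_nseq sn.
have sum_one s : (s <= n - 1)%N ->
    (\sum_(0 <= j < s) nth 0 (one_match_per_round n) j = s)%N.
  move=> sn; rewrite big_nat (eq_bigr (fun=> 1%N)) => [|j /andP [_ js]].
    by rewrite -big_nat sum_nat_const_nat subn0 muln1.
  by rewrite nth_one // (leq_trans js).
split; rewrite size_nseq; first by move=> s /nth_one ->.
  exact: sum_one.
by move=> s sn; rewrite nth_one // /alive_before sum_one; lia.
Qed.

(** * Splitting rounds into single matches *)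

Section Splitting.
Variables (R : realFieldType) (x : R).
Hypotheses (x_gt0 : 0 < x) (x_lt1 : x < 1).

(** Probability that a player who loses each match with probability x / 2 is
    never eliminated, when n players are alive and the rounds m are to come. *)
Fixpoint survival (n : nat) (m : seq nat) : R :=
  if m is k :: m' then (1 - k%:R * x / n%:R) * survival (n - k)%N m' else 1.

(** For n = 0 this holds because division by 0 gives 0. *)
Lemma factor_gt0 (n k : nat) : (k <= n)%N -> 0 < 1 - k%:R * x / n%:R.
Proof.
case: n => [|n] kn; first by rewrite invr0 mulr0 subr0 ltr01.
rewrite subr_gt0 ltr_pdivrMr ?ltr0n // mul1r.
apply: (@le_lt_trans _ _ (n.+1%:R * x)).
  by rewrite ler_pM2r // ler_nat.
by rewrite gtr_pMr // ltr0n.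
Qed.

Lemma survival_one_matchS (n : nat) : (0 < n)%N ->
  survival n.+1 (one_match_per_round n.+1)
    = (1 - x / n.+1%:R) * survival n (one_match_per_round n).
Proof.
case: n => // n _; rewrite /one_match_per_round !subn1 /= mul1r.
by rewrite subn1.
Qed.

Lemma survival_one_match_gt0 (n : nat) : 0 < survival n (one_match_per_round n).
Proof.
elim: n => [|[|n] IHn]; [exact: ltr01 | exact: ltr01 |].
rewrite survival_one_matchS // mulr_gt0 //.
by have := @factor_gt0 n.+2 1 isT; rewrite mul1r.
Qed.

(** Replacing a round of k matches by k rounds of one match hurts the strong
    player. By induction on k, it is enough to compare k + 2 simultaneous
    matches with one match followed by a round of k + 1 matches. *)
Lemma split_round (n k : nat) : (0 < k < n)%N ->
  survival n (one_match_per_round n)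
    <= (1 - k%:R * x / n%:R) * survival (n - k) (one_match_per_round (n - k))
    ?= iff (k == 1%N).
Proof.
elim: k n => [//|[|k] IHk] [//|n] /=; rewrite ltnS => n_gt0.
  by rewrite survival_one_matchS // mul1r subn1; apply/leif_refl.
have {IHk} := IHk n n_gt0.
rewrite survival_one_matchS ?(leq_trans _ n_gt0) // subSS.
set s := survival (n - _) _; move=> IH.
pose one_then_rest := (1 - x / n.+1%:R) * ((1 - k.+1%:R * x / n%:R) * s).
apply/leifP/(@le_lt_trans _ _ one_then_rest).
  rewrite ler_pM2l ?IH.1 //.
  by have := @factor_gt0 n.+1 1 isT; rewrite mul1r.
rewrite /one_then_rest mulrA ltr_pM2r ?survival_one_match_gt0 //.
have n0 : (n%:R : R) != 0 by rewrite pnatr_eq0; lia.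
have n10 : (n.+1%:R : R) != 0 by rewrite pnatr_eq0.
rewrite -subr_gt0.
(* The factor 1 - x: the two ways of playing are equivalent for x = 1, that is
   when all the players are equal. *)
have -> : 1 - k.+2%:R * x / n.+1%:R
      - (1 - x / n.+1%:R) * (1 - k.+1%:R * x / n%:R)
    = k.+1%:R * x * (1 - x) / (n%:R * n.+1%:R) :> R.
  rewrite -![_.+1%:R]natr1; rewrite -natr1 in n10; field; exact/andP.
rewrite divr_gt0 ?mulr_gt0 ?ltr0n ?subr_gt0 //; lia.
Qed.

(** The first round is split by [split_round] and the remaining ones by
    induction; equality forces it in both places, so a minimizing format has
    only rounds of one match. *)
Lemma survival_min (n : nat) (m : seq nat) : (0 < n)%N -> is_format n m ->
  survival n (one_match_per_round n) <= survival n m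
    ?= iff (m == one_match_per_round n).
Proof.
elim: m n => [|k m IHm] n n_gt0 fm.
  have [_ /= + _] := fm; rewrite big_geq // => n1.
  by rewrite /one_match_per_round -n1; apply/leif_refl.
have [k_gt0 le2k fm'] := is_format_cons fm.
have nk_gt0 : (0 < n - k)%N by lia.
have kn : (k <= n)%N by lia.
have -> : (k :: m == one_match_per_round n)
    = (k == 1%N) && (m == one_match_per_round (n - k)).
  rewrite /one_match_per_round.
  have -> : (n - 1 = (n - 2).+1)%N by lia.
  rewrite /= eqseq_cons; case: (eqVneq k 1%N) => //= ->.
  by rewrite -subnDA.
apply: leif_trans (split_round _) _; first by lia.
have [le_m eq_m] := IHm _ nk_gt0 fm'.
have f_gt0 := factor_gt0 kn.
by split; rewrite ?ler_pM2l // (inj_eq (mulfI _)) // gt_eqF.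
Qed.
End Splitting.

(** * The winning probability of the strong player *)

(** The number of alive players evolves deterministically, so by induction the
    law of the remaining rounds enters only through the survival of i in the
    first one. *)
Lemma alive_law_survival (R : realFieldType) (n : nat) (v : 'I_n -> R) (i : 'I_n)
    (w : R) (v_gt0 : forall j, 0 < v j) (v_eq : forall j, j != i -> v j = w)
    (w_gt0 : 0 < w) (m : seq nat) (A : {set 'I_n}) :
  (0 < #|A|)%N -> is_format #|A| m ->
  alive_law v m A [set i]
    = (i \in A)%:R * survival (2 * w / (v i + w)) #|A| m.
Proof.
elim: m A => [|k m IHm] A A_gt0 fm /=.
  have [_ /= + _] := fm; rewrite big_geq // => cA; rewrite mulr1.
  have /cards1P [j ->] : #|A| == 1%N by rewrite -(subnK A_gt0) -cA.
  by rewrite inE (inj_eq set1_inj) eq_sym.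
have [k_gt0 le2k fm'] := is_format_cons fm.
rewrite [RHS]mulrA -round_survival // mulr_suml.
under [RHS]eq_bigr => C _ do rewrite -mulrA.
rewrite !sum_round_law; apply: eq_bigr => S SA; congr (_ * _).
apply: eq_bigr => M MS; congr (_ * _); apply: eq_bigr => W trW; congr (_ * _).
have cC := card_survivors SA MS trW.
by rewrite IHm ?cC //; lia.
Qed.

Theorem theorem5 (R : realFieldType) (n : nat) (hn : (2 <= n)%N)
    (v : 'I_n -> R) (w : R)
    (v1_gt : w < v (player1 hn))
    (v_eq : forall i : 'I_n, i != player1 hn -> v i = w)
    (w_gt0 : 0 < w) :
  unique (minimizes_win_prob v (player1 hn)) (one_match_per_round n).
Proof.
set i := player1 hn in v1_gt v_eq *.
have n_gt0 : (0 < n)%N := ltnW hn.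
have v_gt0 j : 0 < v j.
  by case: (eqVneq j i) => [->|/v_eq -> //]; apply: lt_trans v1_gt.
have vw_gt0 : 0 < v i + w by rewrite addr_gt0.
set x := 2 * w / (v i + w).
have x_gt0 : 0 < x by rewrite divr_gt0 // mulr_gt0.
have x_lt1 : x < 1 by rewrite ltr_pdivrMr // mul1r; lra.
have winE m : is_format n m -> win_prob v m i = survival x n m.
  move=> fm; rewrite /win_prob (alive_law_survival v_gt0 v_eq w_gt0).
  - by rewrite inE mul1r cardsT card_ord.
  - by rewrite cardsT card_ord.
  by rewrite cardsT card_ord.
have minE m (fm : is_format n m) := survival_min x_gt0 x_lt1 n_gt0 fm.
have f1 := is_format_one_match n.
split=> [|m [fm min_m]].
  by split=> // m fm; rewrite !winE //; apply: (minE m fm).1.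
apply/esym/eqP; rewrite -(minE m fm).2 eq_le (minE m fm).1 /=.
by rewrite -!winE //; apply: min_m.
Qed.
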